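(* Let $\mathbf{r}$ and $\mathbf{s}$ be birational sequences of length $m$ and $n$ respectively, let $R\subseteq\mathfrak{S}_m$ be a congruence class of $\equiv_{\mathbf{r}}$ and let $S\subseteq\mathfrak{S}_n$ be a congruence class of $\equiv_{\mathbf{s}}$. Then the shifted shuffle $R\,\bar{ш}\,S=\bigcup_{\rho\in R,\ \sigma\in S}\rho\,\bar{ш}\,\sigma\subseteq\mathfrak{S}_{m+n}$ is a disjoint union of congruence classes of $\equiv_{\mathbf{rs}}$, where $\mathbf{rs}$ is the concatenation of $\mathbf{r}$ and $\mathbf{s}$ (a birational sequence of length $m+n$).
   Context: Notation: $[n]=\{1,\dots,n\}$ and $]i,j[\,=\{i+1,\dots,j-1\}$ for $i<j$. The weak order on the permutations $\mathfrak{S}_n$ of $[n]$ is the lattice defined by $\sigma\le\tau$ iff $\mathrm{inv}(\sigma)\subseteq\mathrm{inv}(\tau)$, where $\mathrm{inv}(\sigma)=\{(\sigma_p,\sigma_q) : p<q,\ \sigma_p>\sigma_q\}$. A lattice congruence is an equivalence relation on $\mathfrak{S}_n$ compatible with meets and joins. Arcs. An arc is a quadruple $(i,j,A,B)$ with $1\le i<j\le n$ and $A\sqcup B={]i,j[}$; $\mathcal{A}_n$ is the set of all arcs. The up arc is $u(i,j)=(i,j,]i,j[,\varnothing)$ and the down arc is $d(i,j)=(i,j,\varnothing,]i,j[)$. The arc $(i,j,A,B)$ is a subarc of $(i',j',A',B')$ if $i'\le i<j\le j'$, $A\subseteq A'$ and $B\subseteq B'$. For an arc $\alpha=(i,j,A,B)$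 let $\sigma_\alpha$ be the permutation with a single descent whose one-line notation is $1,\dots,i-1$, then the elements of $A$ in increasing order, then $j$, then $i$, then the elements of $B$ in increasing order, then $j+1,\dots,n$. For a lattice congruence $\equiv$, let $\mathcal{A}_\equiv$ be the set of arcs $\alpha$ such that $\sigma_\alpha$ is the minimum of its $\equiv$-class. The map $\equiv\ \mapsto\mathcal{A}_\equiv$ is a bijection from the lattice congruences of the weak order on $\mathfrak{S}_n$ to the subsets of $\mathcal{A}_n$ closed under taking subarcs. Birational sequences. A birational sequence of length $n$ is a sequence $\mathbf{r}=((r_1,r'_1),\dots,(r_n,r'_n))$ of pairs of non-negative rational numbers ($r_k$ labels a wall above the point $k$ and $r'_k$ a wall below it). The congruence $\equiv_{\mathbf{r}}$ is the lattice congruence of the weak order on $\mathfrak{S}_n$ such that $\mathcal{A}_n\setminus\mathcal{A}_{\equiv_{\mathbf{r}}}$ is the set of arcs having as a subarc some up arc $u(i,j)$ with $\sum_{k\in]i,j[}r_k\ge1$ or some down arc $d(i,j)$ with $\sum_{k\in]i,j[}r'_k\ge1$. Shifted shuffle. For $\rho\in\mathfrak{S}_m$ and $\sigma\in\mathfrak{S}_n$, the shifted shuffle $\rho\,\bar{ш}\,\sigma$ is the set of permutations of $\mathfrak{S}_{m+n}$ in which the values $1,\dots,m$ appear in the same relative order as in $\rho$ and the values $m+1,\dots,m+n$ appear in the same relative order as the values of $\sigma$ shifted by $m$. *)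

(* Defs.v *)
From mathcomp Require Import all_boot all_order all_algebra all_fingroup.

Set Implicit Arguments.
Unset Strict Implicit.
Unset Printing Implicit Defensive.

Import Order.TTheory GRing.Theory Num.Theory.

(* Positions and values are indexed from 0: [n] is represented by 'I_n, and a
   permutation s : 'S_n has one-line notation s 0, s 1, ..., s (n - 1). *)

Section WeakOrder.
Variable n : nat.
Implicit Types s t u : 'S_n.

Definition inv_set s : {set 'I_n * 'I_n} :=
  [set (s pq.1, s pq.2) | pq : 'I_n * 'I_n & (pq.1 < pq.2) && (s pq.2 < s pq.1)].

Definition weak_le : rel 'S_n := [rel s t | inv_set s \subset inv_set t].

Definition is_meet s t u : Prop :=
  [/\ weak_le u s, weak_le u t &
      forall v, weak_le v s -> weak_le v t -> weak_le v u].

Definition is_join s t u : Prop :=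
  [/\ weak_le s u, weak_le t u &
      forall v, weak_le s v -> weak_le t v -> weak_le u v].

Definition lattice_congruence (E : rel 'S_n) : Prop :=
  [/\ equivalence_rel E,
      forall s s' t t' u u', E s s' -> E t t' ->
        is_meet s t u -> is_meet s' t' u' -> E u u' &
      forall s s' t t' u u', E s s' -> E t t' ->
        is_join s t u -> is_join s' t' u' -> E u u'].

Definition classes_of (E : rel 'S_n) : {set {set 'S_n}} :=
  equivalence_partition E [set: 'S_n].

Definition class_min (E : rel 'S_n) s : bool := [forall t, E s t ==> weak_le s t].

Definition one_line s : seq 'I_n := [seq s p | p <- enum 'I_n].

End WeakOrder.

Notation quad n := ('I_n * 'I_n * {set 'I_n} * {set 'I_n})%type.

Section Arcs.
Variable n : nat.

Implicit Types a b : quad n.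

Definition arc_i a : 'I_n := a.1.1.1.
Definition arc_j a : 'I_n := a.1.1.2.
Definition arc_A a : {set 'I_n} := a.1.2.
Definition arc_B a : {set 'I_n} := a.2.

Definition between (i j : 'I_n) : {set 'I_n} := [set k : 'I_n | i < k < j].

Definition arcs : {set quad n} :=
  [set a | [&& arc_i a < arc_j a,
               arc_A a :|: arc_B a == between (arc_i a) (arc_j a) &
               [disjoint arc_A a & arc_B a]]].

Definition up_arc (i j : 'I_n) : quad n := (i, j, between i j, set0).
Definition down_arc (i j : 'I_n) : quad n := (i, j, set0, between i j).

Definition subarc a b : bool :=
  [&& arc_i b <= arc_i a, arc_j a <= arc_j b,
      arc_A a \subset arc_A b & arc_B a \subset arc_B b].

(* [enum] lists the elements of a subset of 'I_n in increasing order. *)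
Definition arc_word a : seq 'I_n :=
  enum [set k : 'I_n | k < arc_i a] ++ enum (arc_A a) ++
  [:: arc_j a; arc_i a] ++
  enum (arc_B a) ++ enum [set k : 'I_n | arc_j a < k].

(* The default value 1 is only reached outside [arcs], see [arc_permE]. *)
Definition arc_perm a : 'S_n :=
  odflt 1%g [pick s : 'S_n | one_line s == arc_word a].

Definition arcs_of (E : rel 'S_n) : {set quad n} :=
  [set a in arcs | class_min E (arc_perm a)].

End Arcs.

Lemma arc_permE n (a : quad n) :
  a \in arcs n -> one_line (arc_perm a) = arc_word a.
Proof.
case: a => [[[i j] A] B]; rewrite inE /arc_i /arc_j /arc_A /arc_B /=.
case/and3P=> ltij /eqP AB dAB.
set a : quad n := (i, j, A, B).
have memAB k : (k \in A) || (k \in B) = (i < k < j).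
  by have := in_setU k A B; rewrite AB inE.
have nAB k : k \in A -> k \in B = false.
  by move=> kA; apply: (disjointFr dAB kA).
have cntE k : count_mem k (arc_word a) = 1.
  rewrite /arc_word !count_cat /= !count_uniq_mem ?enum_uniq //.
  rewrite !mem_enum !inE /arc_i /arc_j /arc_A /arc_B /= -!val_eqE /=.
  have := memAB k; have := nAB k.
  case: (k \in A); case: (k \in B) => //= h.
  - by have := h isT.
  - by case: (ltngtP i k) => // ik; case: (ltngtP j k) => // jk;
       rewrite ?andbF.
  - by case: (ltngtP i k) => // ik; case: (ltngtP j k) => // jk;
       rewrite ?andbF.
  - case: (ltngtP i k) => // ik; case: (ltngtP j k) => // jk _ //=.
    + by have := ltn_trans (ltn_trans jk ik) ltij; rewrite ltnn.
    + by have := ltn_trans ik ltij; rewrite -jk ltnn.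
    + by move: ltij; rewrite ik ltnNge ltnW.
    + by move: ltij; rewrite ik jk ltnn.
have uw : uniq (arc_word a).
  by apply: count_mem_uniq => k; rewrite cntE -has_pred1 has_count cntE.
have pw : perm_eq (enum 'I_n) (arc_word a).
  apply: uniq_perm; rewrite ?enum_uniq // => k.
  by rewrite mem_enum -has_pred1 has_count cntE.
have sw : size (arc_word a) = n by rewrite -(perm_size pw) size_enum_ord.
have inj : injective (fun p : 'I_n => nth i (arc_word a) p).
  by move=> p q /eqP; rewrite nth_uniq ?sw // => /eqP /val_inj.
rewrite /arc_perm; case: pickP => [s /eqP // | /(_ (perm inj))].
suff -> : one_line (perm inj) = arc_word a by rewrite eqxx.
apply: (@eq_from_nth _ i) => [|k]; first by rewrite size_map size_enum_ord sw.
rewrite size_map size_enum_ord => ltkn.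
by rewrite (nth_map i) ?size_enum_ord // permE nth_enum_ord.
Qed.

Section Birational.
Local Open Scope ring_scope.

Definition birational n (r : n.-tuple (rat * rat)) : bool :=
  all (fun x => (0 <= x.1) && (0 <= x.2)) r.

Definition contracted_arcs n (r : n.-tuple (rat * rat)) : {set quad n} :=
  [set a in arcs n | [exists i : 'I_n, exists j : 'I_n, (i < j)%N &&
     (subarc (up_arc i j) a && (1 <= \sum_(k in between i j) (tnth r k).1) ||
      subarc (down_arc i j) a && (1 <= \sum_(k in between i j) (tnth r k).2))]].

(* By the bijection between lattice congruences and sets of arcs closed under
   taking subarcs, this determines E uniquely (up to pointwise equality). *)
Definition birational_congruence n (r : n.-tuple (rat * rat)) (E : rel 'S_n) :
    Prop :=
  lattice_congruence E /\ arcs n :\: arcs_of E = contracted_arcs r.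

End Birational.

Section ShiftedShuffle.
Variables m n : nat.

(* s^-1 v is the position of the value v in the one-line notation of s. *)
Definition shifted_shuffle (rho : 'S_m) (sigma : 'S_n) : {set 'S_(m + n)} :=
  [set t : 'S_(m + n) |
     [forall u : 'I_m, forall v : 'I_m,
        ((t^-1)%g (lshift n u) < (t^-1)%g (lshift n v)) ==
        ((rho^-1)%g u < (rho^-1)%g v)] &&
     [forall u : 'I_n, forall v : 'I_n,
        ((t^-1)%g (rshift m u) < (t^-1)%g (rshift m v)) ==
        ((sigma^-1)%g u < (sigma^-1)%g v)]].

Definition shifted_shuffle_set (R : {set 'S_m}) (S : {set 'S_n}) :
    {set 'S_(m + n)} :=
  \bigcup_(rho in R) \bigcup_(sigma in S) shifted_shuffle rho sigma.

End ShiftedShuffle.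

(* Main.v *)
Require Import Defs.
From mathcomp Require Import all_boot all_order all_algebra all_fingroup.
From mathcomp Require Import zify.

Set Implicit Arguments.
Unset Strict Implicit.
Unset Printing Implicit Defensive.

(** Membership in the shifted shuffle of R and S depends only on the restriction
    of a permutation to the small values and on its restriction to the large
    values, and these must lie in R and in S. So the claim is that restricting
    to either interval of values sends permutations congruent for rs to
    permutations congruent for r, respectively s: the shuffle is then a union
    of classes.

    Since a class of a lattice congruence contains the meets of its elements
    and all elements between two of its comparable elements, it is enough to
    treat a cover of the weak order, which exchanges two adjacent values i < j.
    Such a cover of upper element t is perspective to the pair formed by
    sigma_a and its lower cover, where a is the arc (i, j, A, B) with A the
    values of ]i, j[ placed before j in t and B those placed after i. Hence a
    congruence collapses the cover exactly when it contracts a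
    ([cong_cut_arc]), which for a birational congruence is a condition on the
    sums over the up and down subarcs of a ([birational_cover]).

    Now restrict a collapsed cover to an interval of values. If i or j falls
    outside of the interval, the two restrictions are equal. Otherwise they
    form a cover, and its arc is the same arc with relabelled values. All its
    subarcs lie in the interval [i, j], on which the concatenation rs agrees
    with r (or s), so the same subarc witnesses that it is contracted ([contracted_cut_arc]).

    The reduction to covers uses meets, so their existence in the weak order
    is established first ([meet_exists]): the pairs that the meet leaves in
    order are the transitive closure of the pairs that one of the two
    permutations leaves in order. *)

(** * Positions of values and the weak order *)

Section Before.
Variable n : nat.
Implicit Types (s t u : 'S_n) (x y z : 'I_n).

Definition before s : rel 'I_n := [rel x y | (s^-1)%g x < (s^-1)%g y].

Lemma before_irr s x : before s x x = false.
Proof. exact: ltnn. Qed.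

Lemma before_trans s : transitive (before s).
Proof. by move=> y x z; exact: ltn_trans. Qed.

Lemma before_neg s x y : x != y -> before s y x = ~~ before s x y.
Proof.
move=> neq; have: (s^-1)%g x != (s^-1)%g y :> nat.
  by rewrite (inj_eq (@ord_inj n)) (inj_eq perm_inj).
by rewrite /before /=; lia.
Qed.

Lemma mem_inv_set s x y : ((y, x) \in inv_set s) = (x < y) && before s y x.
Proof.
apply/imsetP/andP => [[[p q] /=]|[ltxy byx]].
  by rewrite inE /= => /andP[ltpq lts] [-> ->]; rewrite /before /= !permK.
exists ((s^-1)%g y, (s^-1)%g x); last by rewrite /= !permKV.
by rewrite inE /= !permKV ltxy andbT.
Qed.

(** Inclusion of inversion sets, read on the complements: the arguments below
    mostly compare which pairs of values are left in increasing order. *)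
Lemma weak_leP s t :
  reflect (forall x y, x < y -> before t x y -> before s x y) (weak_le s t).
Proof.
have neq x y : x < y -> x != y by move=> ltxy; rewrite -val_eqE ltn_eqF.
apply: (iffP subsetP) => [sub x y ltxy | sub [y x]].
  have := sub (y, x); rewrite !mem_inv_set ltxy !(before_neg _ (neq _ _ ltxy)).
  by move=> h; apply: contraTT h.
rewrite !mem_inv_set => /andP[ltxy]; rewrite ltxy.
by rewrite !(before_neg _ (neq _ _ ltxy)); apply/contra/sub.
Qed.

Lemma weak_le_refl s : weak_le s s.
Proof. exact: subxx. Qed.

Lemma weak_le_trans : transitive (@weak_le n).
Proof. by move=> t s u; apply: subset_trans. Qed.

(** A permutation is determined by the relative order of its values, as the
    position of a value is the number of values before it. *)
Lemma before_ext s t : (forall x y, before s x y = before t x y) -> s = t.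
Proof.
have posE u y : (u^-1)%g y = #|[set z | before u z y]| :> nat.
  have -> : [set z | before u z y] = u @: [set q : 'I_n | q < (u^-1)%g y].
    apply/setP=> z; rewrite inE; apply/idP/imsetP => [bzy|[q]].
      by exists ((u^-1)%g z); rewrite ?inE // permKV.
    by rewrite inE /before /= => ltq ->; rewrite permK.
  rewrite card_imset; last exact: perm_inj.
  rewrite -sum1dep_card (big_ord_narrow (ltnW (ltn_ord ((u^-1)%g y)))) /=.
  by rewrite sum1_card card_ord.
move=> eqb; apply: (can_inj (@invgK _)); apply/permP=> x; apply: val_inj.
by rewrite /= !posE; apply: eq_card => z; rewrite !inE eqb.
Qed.

Lemma weak_le_anti s t : weak_le s t -> weak_le t s -> s = t.
Proof.
move=> /weak_leP st /weak_leP ts; apply: before_ext => x y.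
case: (ltngtP x y) => [ltxy|ltyx|/val_inj->]; last by rewrite !before_irr.
  by apply/idP/idP; [apply: ts | apply: st].
rewrite !(@before_neg _ y x) -?val_eqE ?ltn_eqF //.
by congr (~~ _); apply/idP/idP; [apply: ts | apply: st].
Qed.

(** The position of a value is its rank, the number of its predecessors. *)
Lemma perm_of_order (R : rel 'I_n) :
    irreflexive R -> transitive R -> (forall x y, x != y -> R x y || R y x) ->
  exists s, before s =2 R.
Proof.
move=> Rirr Rtr Rtot; pose rank x := #|[set z | R z x]|.
have rank_lt x : rank x < n.
  rewrite -[X in _ < X]card_ord -cardsT; apply: proper_card.
  by rewrite properE subsetT; apply/subsetPn; exists x; rewrite ?inE ?Rirr.
have rank_mono x y : R x y -> rank x < rank y.
  move=> xy; apply: proper_card; apply/properP; split.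
    by apply/subsetP=> z; rewrite !inE => /Rtr; apply.
  by exists x; rewrite !inE ?Rirr.
pose f x := Ordinal (rank_lt x).
have f_inj : injective f.
  move=> x y [eqr]; apply/eqP; apply: contraT => /Rtot /orP[] /rank_mono.
    by rewrite eqr ltnn.
  by rewrite eqr ltnn.
exists (perm f_inj)^-1%g => x y; rewrite /before /= invgK !permE /=.
apply/idP/idP=> [lt|/rank_mono//].
have [eqxy|/Rtot /orP[//|/rank_mono]] := eqVneq x y.
  by move: lt; rewrite eqxy ltnn.
by rewrite ltnNge ltnW.
Qed.

(** The transitive closure of the non-inversions of s and t is the set of
    non-inversions of the meet. What makes it the set of non-inversions of some
    permutation is that its complement is transitive as well ([Ncut] in the
    proof): a chain from x to z that does not go through a middle value y steps
    over it, and in the permutation that provides the step, y comes after the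
    lower end or before the upper end. *)
Lemma meet_exists s t : exists u, is_meet s t u.
Proof.
pose N := [rel x y : 'I_n | (x < y) && (before s x y || before t x y)].
have Nle x y : connect N x y -> x <= y.
  case/connectP=> p; elim: p x => [|z p IH] x /=; first by move=> _ ->.
  case/andP=> /andP[ltxz _] pth Ey; exact: leq_trans (ltnW ltxz) (IH z pth Ey).
have Ncut x y z : x < y -> y < z -> connect N x z ->
    connect N x y || connect N y z.
  move=> ltxy ltyz /connectP[p]; elim: p x ltxy => [|w p IH] x ltxy /=.
    by move=> _ Ez; move: ltxy ltyz; rewrite Ez; lia.
  case/andP=> Nxw pw Ez.
  have Cxw : connect N x w by apply: connect1.
  have Cwz : connect N w z by apply/connectP; exists p.
  have [ltwy|ltyw|/val_inj Ew] := ltngtP w y; last by rewrite -Ew Cxw.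
    have /orP[wy|->] := IH w ltwy pw Ez; last by rewrite orbT.
    by rewrite (connect_trans Cxw wy).
  have: N x y || N y w.
    case/andP: Nxw => ltxw; rewrite /N /= ltxy ltyw /before /=.
    by case/orP=> b; apply: contraT; lia.
  case/orP=> [/(@connect1 _ N)->//|/(@connect1 _ N) Cyw].
  by rewrite (connect_trans Cyw Cwz) orbT.
(* By transitivity and Ncut, R is a strict linear order on values. *)
pose R := [rel x y : 'I_n |
  if x < y then connect N x y else (y < x) && ~~ connect N y x].
have [|||u uE] := @perm_of_order R.
- by move=> x; rewrite /= ltnn.
- move=> y x z /=.
  have tr a b c := @connect_trans _ N b a c.
  have [lxy|lyx|//] := ltngtP x y; have [lyz|lzy|//] := ltngtP y z.
  + by rewrite (ltn_trans lxy lyz); apply: tr.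
  + have [lxz|lzx|/val_inj Exz] := ltngtP x z.
    * by move=> xy nzy; have := Ncut _ _ _ lxz lzy xy; rewrite (negPf nzy) orbF.
    * by move=> /= xy; apply: contra => zx; apply: tr zx xy.
    * by rewrite Exz => ->.
  + have [lxz|lzx|/val_inj Exz] := ltngtP x z.
    * by move=> nyx yz; have := Ncut _ _ _ lyx lxz yz; rewrite (negPf nyx).
    * by move=> /= nyx yz; apply: contra nyx => zx; apply: tr yz zx.
    * by rewrite Exz => /negPf->.
  + rewrite ltnNge (ltnW (ltn_trans lzy lyx)) (ltn_trans lzy lyx) /=.
    move=> nyx nzy; apply/negP=> /(Ncut _ _ _ lzy lyx).
    by rewrite (negPf nyx) (negPf nzy).
- move=> x y; rewrite -val_eqE /=.
  by case: (ltngtP x y) => //= _ _; rewrite ?orbN // orNb.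
have uN x y : x < y -> before u x y = connect N x y.
  by move=> ltxy; rewrite uE /= ltxy.
exists u; split.
- by apply/weak_leP=> x y ltxy b; rewrite uN // connect1 //= ltxy b.
- by apply/weak_leP=> x y ltxy b; rewrite uN // connect1 //= ltxy b orbT.
move=> v /weak_leP vs /weak_leP vt; apply/weak_leP=> x y ltxy; rewrite uN //.
case/connectP=> p; elim: p x ltxy => [|w p IH] x ltxy /=.
  by move=> _ Ey; move: ltxy; rewrite Ey ltnn.
case/andP=> /andP[ltxw bxw] pw Ey.
have vxw : before v x w by case/orP: bxw; [apply: vs | apply: vt].
have := Nle w y; rewrite leq_eqVlt => /(_ _)/orP[].
- by apply/connectP; exists p.
- by move/eqP/val_inj <-.
- by move/IH/(_ pw Ey); apply: before_trans.
Qed.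

End Before.

(** * Covers of the weak order *)

Section Covers.
Variable n : nat.
Implicit Types (s t u : 'S_n) (x y z i j : 'I_n).

(** The cover relation of the weak order, expressed on relative orders rather
    than as an exchange of adjacent positions: the inversions of t are those of
    s together with (j, i). In this form it restricts well to intervals of
    values. *)
Definition swap_cover i j s t : Prop :=
  [/\ i < j, before t j i &
      forall x y, x < y ->
        before s x y = before t x y || (x == i) && (y == j)].

Lemma swap_cover_le i j s t : swap_cover i j s t -> weak_le s t.
Proof. by case=> _ _ E; apply/weak_leP=> x y lt b; rewrite E ?b. Qed.

Lemma swap_cover_before i j s t : swap_cover i j s t -> before s i j.
Proof. by case=> ltij _ E; rewrite E // !eqxx orbT. Qed.

Lemma swap_coverW i j s t u : swap_cover i j s t ->
  weak_le u t -> before u i j -> weak_le u s.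
Proof.
case=> _ _ E /weak_leP ut bij; apply/weak_leP=> x y lt; rewrite E //.
by case/orP=> [|/andP[/eqP-> /eqP->]//]; apply: ut.
Qed.

Lemma swap_coverU i j s t u : swap_cover i j s t ->
  weak_le s u -> before u j i -> weak_le t u.
Proof.
case=> ltij _ E /weak_leP su bji; apply/weak_leP=> x y lt b.
have := su _ _ lt b; rewrite E // => /orP[//|/andP[/eqP Ex /eqP Ey]].
by move: b bji; rewrite Ex Ey /before /=; lia.
Qed.

(** Composing with the transposition on the right exchanges the values i and j
    in the one-line notation. *)
Lemma adjacent_swap_cover t i j : i < j -> before t j i ->
    (forall x, before t j x -> before t x i -> False) ->
  swap_cover i j (t * tperm i j)%g t.
Proof.
move=> ltij bji adj.
have neqij : i != j by rewrite -val_eqE ltn_eqF.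
have bE x y : before (t * tperm i j)%g x y =
    before t (tperm i j x) (tperm i j y).
  by rewrite /before /= invMg tpermV !permM.
have adjE x : x != i -> x != j -> before t x i = before t x j.
  move=> xi xj; apply/idP/idP=> b; last exact: before_trans b bji.
  by rewrite (@before_neg _ _ j) 1?eq_sym //; apply/negP=> /adj/(_ b).
have adjE' x : x != i -> x != j -> before t i x = before t j x.
  by move=> xi xj; rewrite !(before_neg _ xi) !(before_neg _ xj) adjE.
split=> // x y ltxy; rewrite bE.
have neqxy : x != y by rewrite -val_eqE ltn_eqF.
case: tpermP => [Ex|Ex|/eqP xi /eqP xj];
  case: tpermP => [Ey|Ey|/eqP yi /eqP yj].
- by rewrite Ex Ey eqxx in neqxy.
- by rewrite Ex Ey !eqxx bji orbT.
- by rewrite Ex (negPf yj) andbF orbF adjE'.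
- by move: ltxy; rewrite Ex Ey; lia.
- by rewrite Ex Ey eqxx in neqxy.
- by rewrite Ex (negPf yj) andbF orbF adjE'.
- by rewrite Ey (negPf xi) orbF adjE.
- by rewrite Ey (negPf xi) orbF adjE.
- by rewrite (negPf xi) orbF.
Qed.

(** Among the values that t inverts and s does not, take two whose positions in
    t are as close as possible. A value k between them in t would give a closer
    such pair, whatever its size, by transitivity of the order of s. So they
    are adjacent and can be exchanged without leaving the permutations
    above s. *)
Lemma weak_lt_swap_cover s t : weak_le s t -> s != t ->
  exists i j t', swap_cover i j t' t /\ weak_le s t'.
Proof.
move=> lest neq; have /weak_leP st := lest.
pose P (p : 'I_n * 'I_n) :=
  [&& p.1 < p.2, before t p.2 p.1 & before s p.1 p.2].
have [p0 Pp0|noP] := pickP P; last first.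
  case/eqP: neq; apply: weak_le_anti lest _; apply/weak_leP=> x y ltxy b.
  have := noP (x, y); rewrite /P /= ltxy b andbT /= (@before_neg _ _ x).
    by move/negbFE.
  by rewrite -val_eqE ltn_eqF.
case: (@arg_minnP _ p0 P (fun p => (t^-1)%g p.1 - (t^-1)%g p.2) Pp0).
move=> [i j] /and3P[/= ltij bji sij] minij.
have neqs (a b : 'I_n) : a < b -> (s^-1)%g a != (s^-1)%g b :> nat.
  move=> lt; rewrite (inj_eq (@ord_inj n)) (inj_eq perm_inj).
  by rewrite -val_eqE ltn_eqF.
exists i, j, (t * tperm i j)%g; have Hc : swap_cover i j (t * tperm i j)%g t.
  apply: adjacent_swap_cover => // k bjk bki.
  have Pik : ~ P (i, k).
    by move=> Pk; have := minij _ Pk; move: bjk bki; rewrite /before /=; lia.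
  have Pkj : ~ P (k, j).
    by move=> Pk; have := minij _ Pk; move: bjk bki; rewrite /before /=; lia.
  have [ltki|ltik|/val_inj Eik] := ltngtP k i;
    last by rewrite Eik before_irr in bki.
    have ski := st _ _ ltki bki.
    by apply: Pkj; rewrite /P /= bjk (before_trans ski sij) andbT; lia.
  have [ltkj|ltjk|/val_inj Ejk] := ltngtP k j;
    last by rewrite Ejk before_irr in bjk.
    have := neqs _ _ ltkj; move: Pik Pkj sij.
    by rewrite /P /= ltik ltkj bjk bki /before /=; lia.
  have sjk := st _ _ ltjk bjk.
  by apply: Pik; rewrite /P /= bki (before_trans sij sjk) andbT; lia.
by split=> //; apply: swap_coverW Hc lest sij.
Qed.

Lemma swap_cover_card i j s t :
  swap_cover i j s t -> #|inv_set s| < #|inv_set t|.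
Proof.
move=> Hc; apply: proper_card; apply/properP; split.
  exact: swap_cover_le Hc.
have sij := swap_cover_before Hc; case: Hc => ltij bji _.
exists (j, i); rewrite mem_inv_set ltij //=.
by move: sij; rewrite /before /=; lia.
Qed.

End Covers.

(** * Lattice congruences *)

Section Congruence.
Variables (n : nat) (E : rel 'S_n).
Hypothesis congE : lattice_congruence E.
Implicit Types (s t u : 'S_n).

Lemma cong_refl s : E s s.
Proof. by have [eqE _ _] := congE; case: (eqE s s s). Qed.

Lemma cong_sym s t : E s t = E t s.
Proof.
have [eqE _ _] := congE; have [_ tr] := eqE s t s; apply/idP/idP => st.
  by rewrite -(tr st) cong_refl.
by have [_ /(_ st) <-] := eqE t s t; rewrite cong_refl.
Qed.

Lemma cong_trans : transitive E.
Proof.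
by move=> t s u st; have [eqE _ _] := congE; case: (eqE s t u) => _ /(_ st) ->.
Qed.

Lemma is_meet_le s t : weak_le s t -> is_meet s t s.
Proof. by move=> st; split; rewrite ?weak_le_refl. Qed.

Lemma is_join_le s t : weak_le s t -> is_join s t t.
Proof. by move=> st; split; rewrite ?weak_le_refl. Qed.

Lemma is_join_ge s t : weak_le t s -> is_join s t s.
Proof. by move=> st; split; rewrite ?weak_le_refl. Qed.

Lemma cong_meet s t u : E s t -> is_meet s t u -> E u s.
Proof.
have [_ cm _] := congE => st m.
rewrite cong_sym in st.
by apply: cm (cong_refl s) st m (is_meet_le (weak_le_refl s)).
Qed.

Lemma cong_convex s u t : weak_le s u -> weak_le u t -> E s t -> E u t.
Proof.
have [_ _ cj] := congE => su ut st.
exact: cj st (cong_refl u) (is_join_le su) (is_join_ge ut).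
Qed.

(** Two covers that add the same inversion (j, i), one below the other, are
    perspective: t0 meets s in s0 and joins it in t. So collapsing one collapses
    the other. *)
Lemma cong_perspective i j s t s0 t0 :
    swap_cover i j s t -> swap_cover i j s0 t0 -> weak_le t0 t ->
  E s t = E s0 t0.
Proof.
move=> c c0 le0; have [_ cm cj] := congE.
have les := swap_cover_le c; have les0 := swap_cover_le c0.
have s0s : weak_le s0 s.
  by apply: swap_coverW c (weak_le_trans les0 le0) (swap_cover_before c0).
apply/idP/idP=> [st|st0].
- apply: cm (cong_refl t0) st _ (is_meet_le le0); split=> // v vt0 vs.
  apply: swap_coverW c0 vt0 _.
  have /weak_leP := vs; apply; last exact: swap_cover_before c.
  by case: c.
- apply: cj (cong_refl s) st0 (is_join_ge s0s) _; split=> // v sv t0v.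
  apply: swap_coverU c sv _.
  case: c0 => ltij bji _.
  move/subsetP: t0v => /(_ (j, i)); rewrite !mem_inv_set ltij bji.
  exact.
Qed.

End Congruence.

(** * Arcs as covers *)

Section ArcPermutations.
Variable n : nat.
Implicit Types (s t : 'S_n) (a : quad n) (x y i j k : 'I_n).

Lemma sorted_enum_set (A : {set 'I_n}) : sorted (relpre val ltn) (enum A).
Proof.
rewrite /enum_mem; apply: sorted_filter.
  by move=> ? ? ?; apply: ltn_trans.
by rewrite -sorted_map -enumT val_enum_ord iota_ltn_sorted.
Qed.

Lemma index_one_line s x : index x (one_line s) = (s^-1)%g x.
Proof.
rewrite -[x in LHS](permKV s) index_map; last exact: perm_inj.
exact: index_enum_ord.
Qed.

(** In a concatenation of two increasing words, the only inversions go from the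
    first word to the second. *)
Lemma index_cat_sorted (w1 w2 : seq 'I_n) x y :
    sorted (relpre val ltn) w1 -> sorted (relpre val ltn) w2 ->
    uniq (w1 ++ w2) -> x \in w1 ++ w2 -> y \in w1 ++ w2 -> x < y ->
  (index x (w1 ++ w2) < index y (w1 ++ w2)) = ~~ ((y \in w1) && (x \in w2)).
Proof.
move=> s1 s2; rewrite cat_uniq !mem_cat !index_cat => /and3P[_ /hasPn dis _].
have tr : transitive (relpre val ltn : rel 'I_n).
  by move=> ? ? ?; apply: ltn_trans.
have mono w : sorted (relpre val ltn) w -> x \in w -> y \in w -> x < y ->
    index x w < index y w.
  move=> sw xw yw ltxy; rewrite ltnNge leq_eqVlt; apply/norP; split.
    apply/eqP=> /(congr1 (nth x w)); rewrite !nth_index // => Eyx.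
    by move: ltxy; rewrite Eyx ltnn.
  apply/negP=> /(sorted_ltn_index tr sw _ _ yw xw) /=; lia.
have [x1|nx1] := boolP (x \in w1); have [y1|ny1] := boolP (y \in w1) => /=.
- by move=> _ _ ltxy; rewrite mono //; apply/esym/negP=> /dis; rewrite x1.
- by rewrite (leq_trans _ (leq_addr _ _)) // index_mem.
- move=> x2 _ _; rewrite x2 /=; apply/negbTE.
  by rewrite -leqNgt (leq_trans _ (leq_addr _ _)) // ltnW // index_mem.
- by move=> x2 y2 ltxy; rewrite ltn_add2l mono.
Qed.

Lemma arc_ltn a : a \in arcs n -> arc_i a < arc_j a.
Proof. by rewrite inE => /and3P[]. Qed.

Lemma mem_arcU a k : a \in arcs n ->
  (k \in arc_A a) || (k \in arc_B a) = (arc_i a < k < arc_j a).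
Proof. by rewrite inE -in_setU => /and3P[_ /eqP-> _]; rewrite inE. Qed.

Lemma arc_disjoint a k : a \in arcs n -> k \in arc_A a -> k \in arc_B a = false.
Proof. by rewrite inE => /and3P[_ _ dis] /(disjointFr dis). Qed.

(** The word of an arc is increasing up to its only descent, from j to i, and
    increasing after it. *)
Lemma arc_perm_before a x y : a \in arcs n -> x < y ->
  before (arc_perm a) x y =
    ~~ (((y == arc_j a) || (y \in arc_A a)) &&
        ((x == arc_i a) || (x \in arc_B a))).
Proof.
move=> aP ltxy; have wE := arc_permE aP.
have uw : uniq (arc_word a).
  by rewrite -wE map_inj_uniq ?enum_uniq //; apply: perm_inj.
have inw z : z \in arc_word a.
  rewrite -wE; apply/mapP; exists ((arc_perm a)^-1 z)%g; last by rewrite permKV.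
  exact: mem_enum.
rewrite /before /= -!index_one_line wE.
have ltij := arc_ltn aP.
have memAB k := @mem_arcU a k aP.
pose w1 :=
  enum [set k : 'I_n | k < arc_i a] ++ rcons (enum (arc_A a)) (arc_j a).
pose w2 := (arc_i a :: enum (arc_B a)) ++ enum [set k : 'I_n | arc_j a < k].
have Ew : arc_word a = w1 ++ w2.
  by rewrite /arc_word /w1 /w2 -cats1 -!catA.
have tr : transitive (relpre val ltn : rel 'I_n).
  by move=> ? ? ?; apply: ltn_trans.
have s1 : sorted (relpre val ltn) w1.
  rewrite /w1 (sorted_pairwise tr) pairwise_cat pairwise_rcons.
  rewrite -!(sorted_pairwise tr) !sorted_enum_set !andbT.
  apply/andP; split.
    apply/allrelP=> k l; rewrite mem_enum inE mem_rcons inE mem_enum => ki.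
    case/orP=> [/eqP->|lA] /=; first exact: ltn_trans ki ltij.
    by have := memAB l; rewrite lA; lia.
  apply/allP=> k; rewrite mem_enum => kA /=.
  by have := memAB k; rewrite kA; lia.
have s2 : sorted (relpre val ltn) w2.
  rewrite /w2 (sorted_pairwise tr) pairwise_cat pairwise_cons.
  rewrite -!(sorted_pairwise tr) !sorted_enum_set !andbT.
  apply/andP; split.
    apply/allrelP=> k l; rewrite [l \in _]mem_enum !inE mem_enum.
    case/orP=> [/eqP->|kB] /= jl; first exact: ltn_trans ltij jl.
    by have := memAB k; rewrite kB orbT; lia.
  apply/allP=> k; rewrite mem_enum => kB /=.
  by have := memAB k; rewrite kB orbT; lia.
rewrite Ew index_cat_sorted // -?Ew //; congr (~~ _).
rewrite /w1 /w2 !mem_cat mem_rcons !inE !mem_enum !inE.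
have ym := memAB y; have xm := memAB x.
have [Exi|nxi] := eqVneq x (arc_i a); first by subst x; lia.
have [Eyj|nyj] := eqVneq y (arc_j a); first by subst y; lia.
by move: ym xm; case: (y \in arc_A a); case: (x \in arc_B a) => /=; lia.
Qed.

Lemma arc_perm_swap_cover a : a \in arcs n ->
  exists s, swap_cover (arc_i a) (arc_j a) s (arc_perm a).
Proof.
move=> aP; have bE x y := @arc_perm_before a x y aP.
have ltij := arc_ltn aP.
have memAB k := @mem_arcU a k aP.
have nAB k := @arc_disjoint a k aP.
have neq x y : x < y -> x != y by move=> ltxy; rewrite -val_eqE ltn_eqF.
have bji : before (arc_perm a) (arc_j a) (arc_i a).
  by rewrite (before_neg _ (neq _ _ ltij)) bE // !eqxx.
eexists; apply: (adjacent_swap_cover ltij bji) => k bjk bki.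
have mk := memAB k; have nk := nAB k.
have [lki|lik|/val_inj Ek] := ltngtP k (arc_i a);
  last by rewrite Ek before_irr in bki.
  have lkj := ltn_trans lki ltij.
  move: bjk; rewrite (before_neg _ (neq _ _ lkj)) bE //.
  by rewrite eqxx (negPf (neq _ _ lki)) /= negbK; lia.
have [lkj|ljk|/val_inj Ek] := ltngtP k (arc_j a);
  last by rewrite Ek before_irr in bjk.
  move: bjk bki; rewrite (before_neg _ (neq _ _ lkj)).
  rewrite (before_neg _ (neq _ _ lik)).
  rewrite !bE // !eqxx (negPf (neq _ _ lkj)) eq_sym (negPf (neq _ _ lik)) /=.
  by rewrite !negbK andbT => kB /nk; rewrite kB.
move: bki; rewrite (before_neg _ (neq _ _ lik)) bE // negbK eqxx andbT.
by rewrite eq_sym (negPf (neq _ _ ljk)) /=; lia.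
Qed.

(** The arc of the join irreducible below s that has the descent (j, i). *)
Definition cut_arc s i j : quad n :=
  (i, j, [set k in between i j | before s k j],
         [set k in between i j | before s i k]).

(** As j and i are adjacent in t, each value of ]i, j[ is either before j or
    after i. *)
Lemma cut_arcP i j s t : swap_cover i j s t -> cut_arc t i j \in arcs n.
Proof.
move=> c; have sij := swap_cover_before c; case: c => ltij bji E.
rewrite inE ltij /=; apply/andP; split; last first.
  rewrite -setI_eq0; apply/eqP/setP=> k; rewrite !inE.
  by move: bji; rewrite /before /=; lia.
apply/eqP/setP=> k; rewrite !inE; have [|//] := boolP (i < k < j).
case/andP=> ik kj /=; apply: contraT => /norP[nkj nik].
have := E _ _ ik; have := E _ _ kj.
rewrite (negPf nkj) (negPf nik) !eqxx /= andbT.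
rewrite -!val_eqE /= (gtn_eqF ik) (ltn_eqF kj).
by move: sij; rewrite /before /=; lia.
Qed.

Lemma arc_perm_cut_le i j s t : swap_cover i j s t ->
  weak_le (arc_perm (cut_arc t i j)) t.
Proof.
move=> c; have aP := cut_arcP c; case: c => ltij bji E.
apply/weak_leP=> x y ltxy bxy; rewrite arc_perm_before // !inE /=.
apply/negP=> /andP[yP xP]; move: bxy.
have yj : y = j \/ before t y j by case/orP: yP => [/eqP|/andP[]]; auto.
have ix : x = i \/ before t i x by case/orP: xP => [/eqP|/andP[]]; auto.
by case: yj ix bji => [->|+] [->|+]; rewrite /before /=; lia.
Qed.

(** The permutation of an arc is join irreducible: anything strictly below it
    has lost the inversion of its descent. Indeed, if s keeps j before i, then
    the values of A remain before j and those of B after i, which forces every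
    inversion. *)
Lemma arc_perm_min a s : a \in arcs n -> weak_le s (arc_perm a) ->
  before s (arc_j a) (arc_i a) -> weak_le (arc_perm a) s.
Proof.
move=> aP /weak_leP les bji; apply/weak_leP=> x y ltxy.
move=> bxy; rewrite arc_perm_before //; apply/negP=> /andP[yP xP].
have ltij := arc_ltn aP.
have memAB k := @mem_arcU a k aP.
have nAB k := @arc_disjoint a k aP.
have byj : y = arc_j a \/ before s y (arc_j a).
  case/orP: yP => [/eqP|yA]; [by left | right]; have := memAB y; rewrite yA /=.
  case/esym/andP=> iy yj; apply: les => //; rewrite arc_perm_before // nAB //.
  have /negPf-> : y != arc_i a by rewrite -val_eqE gtn_eqF.
  by rewrite andbF.
have bix : x = arc_i a \/ before s (arc_i a) x.
  case/orP: xP => [/eqP|xB]; [by left | right].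
  have := memAB x; rewrite xB orbT.
  case/esym/andP=> ix xj; apply: les => //; rewrite arc_perm_before //.
  have -> : x \in arc_A a = false by apply: contraTF xB => /nAB->.
  by rewrite orbF -[x == _]val_eqE /= (ltn_eqF xj).
by case: byj bix bxy bji => [->|+] [->|+]; rewrite /before /=; lia.
Qed.

(** By perspectivity the cover can be taken to be the one whose upper element is
    the permutation of the arc. By join irreducibility, if that permutation is
    not the minimum of its class, then its class contains its lower cover. *)
Lemma cong_cut_arc (E : rel 'S_n) i j s t : lattice_congruence E ->
  swap_cover i j s t -> E s t = (cut_arc t i j \notin arcs_of E).
Proof.
move=> congE c; have aP := cut_arcP c.
have [s0 c0] := arc_perm_swap_cover aP.
rewrite (cong_perspective congE c c0 (arc_perm_cut_le c)) inE aP /=.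
have b0 := swap_cover_before c0; have le0 := swap_cover_le c0.
have [ltij bji _] := c0; apply/idP/forallPn => [E0 | [u]].
  exists s0; rewrite cong_sym // E0 /=; apply/negP=> /weak_leP/(_ _ _ ltij b0).
  by move: bji; rewrite /before /=; lia.
rewrite negb_imply => /andP[Eu nle].
have [w mw] := meet_exists (arc_perm (cut_arc t i j)) u.
have Ew := cong_meet congE Eu mw; have [lew lewu _] := mw.
apply: (cong_convex congE _ le0 Ew); apply: (swap_coverW c0 lew).
have neq : i != j by rewrite -val_eqE ltn_eqF.
rewrite -[before _ _ _]negbK -(before_neg _ neq); apply: contra nle => bw.
exact: weak_le_trans (arc_perm_min aP lew bw) lewu.
Qed.

Lemma birational_cover (r : n.-tuple (rat * rat)) (E : rel 'S_n) i j s t :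
    birational_congruence r E -> swap_cover i j s t ->
  E s t = (cut_arc t i j \in contracted_arcs r).
Proof.
by case=> cE <- c; rewrite (cong_cut_arc cE c) in_setD (cut_arcP c) andbT.
Qed.

End ArcPermutations.

(** * Restriction to an interval of values *)

Section Restriction.
Variables (k n c : nat) (f : 'I_k -> 'I_n).
Hypothesis fE : forall u, f u = c + u :> nat.
Implicit Types (s : 'S_k) (t : 'S_n) (u v i j : 'I_k).

(** The standardization of the subword of t on the values in the image of f is
    s. *)
Definition restricts t s : Prop :=
  forall u v, before t (f u) (f v) = before s u v.

Lemma shift_inj : injective f.
Proof. by move=> u v /(congr1 val); rewrite /= !fE => /addnI /val_inj. Qed.

Lemma shift_ltn u v : (f u < f v) = (u < v).
Proof. by rewrite !fE ltn_add2l. Qed.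

Lemma shift_convex u v (x : 'I_n) : f u <= x <= f v -> exists w, x = f w.
Proof.
rewrite !fE => /andP[le1 le2].
have ltk : x - c < k by have := ltn_ord v; lia.
by exists (Ordinal ltk); apply: val_inj; rewrite /= fE /=; lia.
Qed.

Lemma shift_interval u v (x y : 'I_n) : f u <= x -> x < y -> y <= f v ->
  exists x' y', [/\ x = f x', y = f y', u <= x', x' < y' & y' <= v].
Proof.
move=> ux xy yv.
have [|x' Ex] := @shift_convex u v x.
  by rewrite ux (leq_trans (ltnW xy)).
have [|y' Ey] := @shift_convex u v y.
  by rewrite yv (leq_trans ux) // ltnW.
by exists x', y'; move: ux xy yv; rewrite Ex Ey !fE !leq_add2l ltn_add2l.
Qed.

Lemma shift_between u v : between (f u) (f v) = f @: between u v.
Proof.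
apply/setP=> x; rewrite inE; apply/idP/imsetP => [/andP[ux xv]|[w]].
  have [|w Ew] := @shift_convex u v x; first by rewrite (ltnW ux) (ltnW xv).
  by exists w; rewrite // inE -(shift_ltn u w) -(shift_ltn w v) -Ew ux.
by rewrite inE -(shift_ltn u w) -(shift_ltn w v) => ltw ->.
Qed.

Lemma restriction_exists t : exists s, restricts t s.
Proof.
have [|||s sE] := @perm_of_order _ (relpre f (before t)).
- by move=> u; rewrite /= before_irr.
- by move=> v u w; apply: before_trans.
- move=> u v; rewrite -(inj_eq shift_inj) => neq /=.
  by rewrite (before_neg _ neq) orbN.
by exists s => u v; rewrite sE.
Qed.

Lemma restricts_cover i j s s' t t' : restricts t s -> restricts t' s' ->
  swap_cover (f i) (f j) t t' -> swap_cover i j s s'.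
Proof.
move=> ts ts' [lt b E]; split=> [||u v ltuv].
- by rewrite -(shift_ltn i j).
- by rewrite -ts'.
- by rewrite -ts -ts' E ?shift_ltn // !(inj_eq shift_inj).
Qed.

Lemma restricts_cover_eq (i j : 'I_n) s s' t t' :
    restricts t s -> restricts t' s' ->
  swap_cover i j t t' -> (forall u v, ~ (i = f u /\ j = f v)) -> s = s'.
Proof.
move=> ts ts' [_ _ E] nij.
have le u v : u < v -> before s u v = before s' u v.
  move=> ltuv; rewrite -ts -ts' E ?shift_ltn //.
  have [Ei|_] := eqVneq (f u) i; last by rewrite orbF.
  have [Ej|_] := eqVneq (f v) j; last by rewrite orbF.
  by case: (nij u v); rewrite Ei Ej.
by apply: weak_le_anti; apply/weak_leP=> u v /le->.
Qed.

End Restriction.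

(** * Restriction sends congruent permutations to congruent permutations *)

Section Saturation.
Variables (k n c : nat) (f : 'I_k -> 'I_n).
Hypothesis fE : forall u, f u = c + u :> nat.
Variables (r : k.-tuple (rat * rat)) (rn : n.-tuple (rat * rat)).
Hypothesis rE : forall u, tnth rn (f u) = tnth r u.

Lemma shift_sum (g : rat * rat -> rat) (i j : 'I_k) :
  (\sum_(l in between (f i) (f j)) g (tnth rn l) =
   \sum_(l in between i j) g (tnth r l))%R.
Proof.
rewrite (shift_between fE) big_imset /=; last first.
  by apply: in2W; apply: (shift_inj fE).
by apply: eq_bigr => u _; rewrite rE.
Qed.

(** Subarcs of an arc with ends in the image of f have their ends there too,
    as that image is an interval. *)
Lemma contracted_cut_arc (i j : 'I_k) s t : restricts f t s ->
    cut_arc s i j \in arcs k ->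
    cut_arc t (f i) (f j) \in contracted_arcs rn ->
  cut_arc s i j \in contracted_arcs r.
Proof.
move=> ts aP /setIdP[_ /existsP[x /existsP[y /andP[ltxy H]]]].
apply/setIdP; split=> //; move: H.
case/orP=> /andP[/and4P[/= ix yj sA sB] le1];
  have [x' [y' [Ex Ey ix' ltxy' yj']]] :=
    @shift_interval _ _ _ f fE i j x y ix ltxy yj;
  subst x y; apply/existsP; exists x'; apply/existsP; exists y';
  rewrite ltxy' /=; apply/orP; [left|right]; rewrite -shift_sum le1 andbT;
  apply/and4P; split; rewrite /= ?sub0set //; apply/subsetP=> u;
  rewrite inE -!(shift_ltn fE) => uP.
- by have /subsetP/(_ (f u)) := sA; rewrite !inE !(shift_ltn fE) ts; apply;
    rewrite -!(shift_ltn fE).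
- by have /subsetP/(_ (f u)) := sB; rewrite !inE !(shift_ltn fE) ts; apply;
    rewrite -!(shift_ltn fE).
Qed.

Variables (E : rel 'S_k) (En : rel 'S_n).
Hypotheses (hE : birational_congruence r E) (hEn : birational_congruence rn En).

Lemma restricts_cong_cover i j s t s' t' : swap_cover i j s t -> En s t ->
  restricts f s s' -> restricts f t t' -> E s' t'.
Proof.
move=> cov st ss' tt'; have [congE _] := hE.
have [[u v] /= /andP[/eqP Ei /eqP Ej]|no] :=
    pickP [pred p : 'I_k * 'I_k | (i == f p.1) && (j == f p.2)]; last first.
  rewrite (restricts_cover_eq fE ss' tt' cov); first exact: cong_refl.
  by move=> u v [Ei Ej]; have := no (u, v); rewrite /= -Ei -Ej !eqxx.
subst i j; have cov' := restricts_cover fE ss' tt' cov.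
rewrite (birational_cover hE cov').
apply: (contracted_cut_arc tt' (cut_arcP cov')).
by rewrite -(birational_cover hEn cov).
Qed.

Lemma restricts_cong_le s t s' t' : weak_le s t -> En s t ->
  restricts f s s' -> restricts f t t' -> E s' t'.
Proof.
have [congE _] := hE; have [congEn _] := hEn.
(* Descend from t to s one cover at a time. *)
elim: {t}_.+1 {-2}t (ltnSn #|inv_set t|) t' => // N IH t ltN t' st Est ss' tt'.
have [Est'|neq] := eqVneq s t.
  rewrite (@before_ext _ s' t') => [|u v]; first exact: cong_refl.
  by rewrite -ss' -tt' Est'.
have [i [j [t1 [cov st1]]]] := weak_lt_swap_cover st neq.
have [t1' tt1] := restriction_exists fE t1.
have E1 : En t1 t := cong_convex congEn st1 (swap_cover_le cov) Est.
apply: (cong_trans congE _ (restricts_cong_cover cov E1 tt1 tt')).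
apply: IH st1 _ ss' tt1; first exact: leq_trans (swap_cover_card cov) ltN.
by apply: (cong_trans congEn Est); rewrite cong_sym.
Qed.

Lemma restricts_cong s t s' t' : En s t ->
  restricts f s s' -> restricts f t t' -> E s' t'.
Proof.
move=> Est ss' tt'; have [congE _] := hE; have [congEn _] := hEn.
have [w mw] := meet_exists s t; have [ws wt _] := mw.
have [w' ww'] := restriction_exists fE w.
have Ews := cong_meet congEn Est mw.
apply: (@cong_trans _ _ congE w'); last first.
  exact: restricts_cong_le wt (cong_trans congEn Ews Est) ww' tt'.
by rewrite cong_sym //; apply: restricts_cong_le ws Ews ww' ss'.
Qed.

End Saturation.

(** * Unions of classes and the shifted shuffle *)

Lemma shifted_shuffleP m n (rho : 'S_m) (sigma : 'S_n) (t : 'S_(m + n)) :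
  reflect (restricts (@lshift m n) t rho /\ restricts (@rshift m n) t sigma)
          (t \in shifted_shuffle rho sigma).
Proof.
rewrite inE; apply: (iffP andP) => -[H1 H2]; split.
- by move=> u v; move/forallP/(_ u)/forallP/(_ v)/eqP: H1.
- by move=> u v; move/forallP/(_ u)/forallP/(_ v)/eqP: H2.
- by apply/forallP=> u; apply/forallP=> v; apply/eqP/H1.
- by apply/forallP=> u; apply/forallP=> v; apply/eqP/H2.
Qed.

Lemma classes_of_closed n (E : rel 'S_n) (C : {set 'S_n}) s t :
  lattice_congruence E -> C \in classes_of E -> s \in C -> E s t -> t \in C.
Proof.
move=> congE /imsetP[u _ ->]; rewrite !inE /= => us st.
exact: cong_trans us st.
Qed.

Lemma partition_of_closed n (E : rel 'S_n) (X : {set 'S_n}) :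
    lattice_congruence E -> (forall s t, s \in X -> E s t -> t \in X) ->
  exists2 P : {set {set 'S_n}}, P \subset classes_of E & partition P X.
Proof.
move=> congE Xcl; have [eqE _ _] := congE.
have /and3P[_ triv no0] : partition (classes_of E) [set: 'S_n].
  by apply: equivalence_partitionP => s t u _ _ _; apply: eqE.
exists [set C in classes_of E | C \subset X].
  by apply/subsetP=> C /setIdP[].
apply/and3P; split; last by rewrite inE (negPf no0).
- apply/eqP/setP=> t.
  apply/bigcupP/idP => [[C /setIdP[_ /subsetP sC] /sC //]|Xt].
  exists [set u in [set: 'S_n] | E t u]; last by rewrite !inE cong_refl.
  rewrite inE; apply/andP; split; first by apply/imsetP; exists t; rewrite ?inE.
  by apply/subsetP=> u; rewrite !inE /=; apply: Xcl.
- by apply: trivIsetS triv; apply/subsetP=> C /setIdP[].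
Qed.

Theorem proposition5p2 (m n : nat)
    (r : m.-tuple (rat * rat)) (s : n.-tuple (rat * rat))
    (hr : birational r) (hs : birational s)
    (Er : rel 'S_m) (Es : rel 'S_n) (Ers : rel 'S_(m + n))
    (hEr : birational_congruence r Er)
    (hEs : birational_congruence s Es)
    (hErs : birational_congruence [tuple of r ++ s] Ers)
    (R : {set 'S_m}) (S : {set 'S_n})
    (hR : R \in classes_of Er) (hS : S \in classes_of Es) :
  exists2 P : {set {set 'S_(m + n)}},
    P \subset classes_of Ers & partition P (shifted_shuffle_set R S).
Proof.
have lE (u : 'I_m) : lshift n u = 0 + u :> nat by [].
have rE (u : 'I_n) : rshift m u = m + u :> nat by [].
apply: partition_of_closed; first by case: hErs.
move=> t t' /bigcupP[rho Rrho /bigcupP[sigma Ssigma /shifted_shuffleP[tr ts]]].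
move=> Ett'.
have [rho' tr'] := restriction_exists lE t'.
have [sigma' ts'] := restriction_exists rE t'.
apply/bigcupP; exists rho'.
  apply: (classes_of_closed _ hR Rrho); first by case: hEr.
  by apply: (restricts_cong lE _ hEr hErs Ett' tr tr') => u; apply: tnth_lshift.
apply/bigcupP; exists sigma'; last exact/shifted_shuffleP.
apply: (classes_of_closed _ hS Ssigma); first by case: hEs.
by apply: (restricts_cong rE _ hEs hErs Ett' ts ts') => u; apply: tnth_rshift.
Qed.
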